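(* Let $\mathcal{C},\mathcal{D},\mathcal{B}$ be bicategories such that all 1-cells of $\mathcal{C}$ and $\mathcal{D}$ are dualizable, and suppose $\mathcal{B}$ has a shadow valued in a category $\mathbf{T}$. Let $\iota\colon\mathcal{C}\to\mathcal{D}$ and $\rho\colon\mathcal{C}\to\mathcal{B}$ be strong 2-functors. If the induced representation $I_{\mathcal{C}}^{\mathcal{D}}(\rho)$ is a 0-cell of $(\rho\downarrow\iota^* )^d$, then there is a unique 1-cell $$I_{\Lambda\mathcal{C}}^{\Lambda\mathcal{D}}(\mathcal{X}_\rho)\to\mathcal{X}_{I_{\mathcal{C}}^{\mathcal{D}}(\rho)}$$ in the under bicategory $\mathcal{X}_\rho\downarrow(\Lambda\iota)^*$.
   Context: Composition of 1-cells in a bicategory is written diagrammatically: $M\colon A\to B$ and $N\colon B\to C$ give $M\odot N\colon A\to C$; unit 1-cells are $U_A$; the left and right unitors are $\ell,r$. A strong 2-functor is a pseudofunctor; its structure isomorphisms are written $\phi\colon F(M)\odot F(N)\to F(M\odot N)$. A 1-cell $M\colon A\to B$ is (right) dualizable if there is a 1-cell $M^*\colon B\to A$ and 2-cells $\eta\colon U_A\to M\odot M^*$, $\epsilon\colon M^*\odot M\to U_B$ satisfying the triangle identities. Shadow: functors $\langle\langle-\rangle\rangle\colon\mathcal{B}(R,R)\to\mathbf{T}$ for each 0-cell $R$, with natural isomorphisms $\theta\colon\langle\langle M\odot N\rangle\rangle\to\langle\langle N\odot M\rangle\rangle$ for $M\colon R\to S$, $N\colon S\to R$, such that (suppressing associators)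 $\theta\colon\langle\langle M\odot N\odot P\rangle\rangle\to\langle\langle P\odot M\odot N\rangle\rangle$ equals the composite of $\theta$'s through $\langle\langle N\odot P\odot M\rangle\rangle$, and $\langle\langle\ell\rangle\rangle\circ\theta=\langle\langle r\rangle\rangle$, $\langle\langle r\rangle\rangle\circ\theta=\langle\langle\ell\rangle\rangle$. Trace: for $M$ dualizable and $f\colon Q\odot M\Rightarrow M\odot P$, $\mathrm{tr}(f)$ is the composite $\langle\langle Q\rangle\rangle\xrightarrow{\langle\langle\mathrm{id}\odot\eta\rangle\rangle}\langle\langle Q\odot M\odot M^*\rangle\rangle\xrightarrow{\langle\langle f\odot\mathrm{id}\rangle\rangle}\langle\langle M\odot P\odot M^*\rangle\rangle\xrightarrow{\theta}\langle\langle M^*\odot M\odot P\rangle\rangle\xrightarrow{\langle\langle\epsilon\odot\mathrm{id}\rangle\rangle}\langle\langle P\rangle\rangle$. $\Lambda\mathcal{B}$ is the bicategory whose 0-cells are the endomorphism 1-cells of $\mathcal{B}$; whose 1-cells from $P\colon V\to V$ to $Q\colon W\to W$ are pairs $(M,\psi)$ with $M\colon V\to W$ dualizable and $\psi\colon P\odot M\Rightarrow M\odot Q$; and whose 2-cells $(M,\psi)\Rightarrow(M',\psi')$ are isomorphism 2-cells $\beta\colon M\Rightarrow M'$ with $\psi'\circ(\mathrm{id}_P\odot\beta)=(\beta\odot\mathrm{id}_Q)\circ\psi$; composition of $(M,\beta)\colon P\to Q$ and $(N,\gamma)\colon Q\to T$ is $M\odot N$ with $(\mathrm{id}_M\odot\gamma)\circ(\beta\odot\mathrm{id}_N)$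 (suppressing associators), and units are $(U_V,\ell^{-1}\circ r)$. A strong 2-functor $F$ induces $\Lambda F$ with $P\mapsto F(P)$, $(M,\psi)\mapsto(F(M),\phi^{-1}\circ F(\psi)\circ\phi)$, $\beta\mapsto F(\beta)$. $\mathcal{T}$ is $\mathbf{T}$ regarded as a 2-category with only identity 2-cells. $\chi\colon\Lambda\mathcal{B}\to\mathcal{T}$ is the strict 2-functor $P\mapsto\langle\langle P\rangle\rangle$, $(N,\gamma)\mapsto\mathrm{tr}(\gamma)$. The character of a strong 2-functor $\sigma$ into $\mathcal{B}$ is $\mathcal{X}_\sigma=\chi\circ\Lambda\sigma$. A strong transformation $\zeta\colon\rho\to\sigma$ consists of 1-cells $\zeta_c\colon\rho(c)\to\sigma(c)$ and invertible 2-cells $\zeta_f\colon\zeta_c\odot\sigma(f)\Rightarrow\rho(f)\odot\zeta_{c'}$ for 1-cells $f\colon c\to c'$, compatible with 2-cells, composition and units. $\rho\downarrow\iota^*$ is the bicategory with 0-cells pairs $(\sigma,\zeta)$, $\sigma\colon\mathcal{D}\to\mathcal{B}$ a strong 2-functor and $\zeta\colon\rho\to\sigma\circ\iota$ a strong transformation; 1-cells $(\sigma,\zeta)\to(\sigma',\zeta')$ pairs $(\psi,\alpha)$, $\psi\colon\sigma\to\sigma'$ a strong transformation and $\alpha$ a modification with components $\alpha_c\colon\zeta_c\odot\psi_{\iota(c)}\Rightarrow\zeta'_c$; 2-cells $(\psi,\alpha)\to(\psi',\alpha')$ modifications $\gamma\colon\psi\Rightarrow\psi'$ with $\alpha'_c\circ(\mathrm{id}\odot\gamma_{\iota(c)})=\alpha_c$.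 $I_{\mathcal{C}}^{\mathcal{D}}(\rho)$ is the initial 0-cell of $\rho\downarrow\iota^*$; the symbol also denotes its underlying 2-functor. When all 1-cells of $\mathcal{C}$ and $\mathcal{D}$ are dualizable, $(\rho\downarrow\iota^* )^d$ is the subbicategory of 0-cells $(\sigma,\zeta)$ with every $\zeta_c$ dualizable and 1-cells $(\psi,\alpha)$ with every $\psi_d$ dualizable. $\mathcal{X}_\rho\downarrow(\Lambda\iota)^*$ has 0-cells pairs $(M,\mu)$ with $M\colon\Lambda\mathcal{D}\to\mathcal{T}$ a 2-functor and $\mu\colon\mathcal{X}_\rho\to M\circ\Lambda\iota$ a natural transformation (morphisms $\mu_f\colon\langle\langle\rho(f)\rangle\rangle\to M(\iota(f))$ of $\mathbf{T}$ for endomorphism 1-cells $f$ of $\mathcal{C}$, natural in 1-cells of $\Lambda\mathcal{C}$); 1-cells $(M,\mu)\to(M',\mu')$ are natural transformations $\nu\colon M\to M'$ with $\nu_{\iota(f)}\circ\mu_f=\mu'_f$; 2-cells are equalities. $I_{\Lambda\mathcal{C}}^{\Lambda\mathcal{D}}(\mathcal{X}_\rho)$ is its initial 0-cell. When $I_{\mathcal{C}}^{\mathcal{D}}(\rho)=(\sigma,\zeta)$ lies in $(\rho\downarrow\iota^* )^d$, $\mathcal{X}_{I_{\mathcal{C}}^{\mathcal{D}}(\rho)}$ is regarded as the 0-cell $(\chi\circ\Lambda\sigma,\mu)$ with $\mu_f=\mathrm{tr}(\zeta_f^{-1})\colon\langle\langle\rho(f)\rangle\rangle\to\langle\langle\sigma(\iota(f))\rangle\rangle$.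 The two initial 0-cells are presupposed to exist. *)

(* Defs.v *)
From Stdlib Require Import ssreflect ProofIrrelevance ClassicalEpsilon.

Set Implicit Arguments.
Unset Strict Implicit.
Set Asymmetric Patterns.
Unset Printing Implicit Defensive.

(* Composition is diagrammatic everywhere: [s ;; t] is s followed by t, and
   [M ⊙ N : hom1 a c] for [M : hom1 a b], [N : hom1 b c].  Equality of 2-cells
   is Leibniz equality. *)

Record category := Category {
  cob :> Type;
  hom : cob -> cob -> Type;
  idm : forall x, hom x x;
  comp : forall x y z, hom x y -> hom y z -> hom x z;
  comp_idl : forall x y (s : hom x y), comp (idm x) s = s;
  comp_idr : forall x y (s : hom x y), comp s (idm y) = s;
  compA : forall w x y z (s : hom w x) (t : hom x y) (u : hom y z),
    comp s (comp t u) = comp (comp s t) u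
}.

Arguments hom {c} x y.
Arguments idm {c} x.
Arguments comp {c x y z} s t.
Arguments comp_idl {c x y} s.
Arguments comp_idr {c x y} s.
Arguments compA {c w x y z} s t u.
Notation "s ;; t" := (comp s t) (at level 50, left associativity).

Record iso (C : category) (x y : C) := Iso {
  fwd :> hom x y;
  bwd : hom y x;
  fwdK : fwd ;; bwd = idm x;
  bwdK : bwd ;; fwd = idm y
}.

Arguments fwd {C x y} i.
Arguments bwd {C x y} i.
Arguments fwdK {C x y} i.
Arguments bwdK {C x y} i.

Definition iso_id (C : category) (x : C) : iso x x :=
  Iso (comp_idl (idm x)) (comp_idl (idm x)).

Definition iso_inv (C : category) (x y : C) (i : iso x y) : iso y x :=
  Iso (bwdK i) (fwdK i).

Lemma iso_comp_subproof (C : category) (x y z : C) (i : iso x y) (j : iso y z) :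
  (i ;; j) ;; (bwd j ;; bwd i) = idm x.
Proof. by rewrite compA -(compA (fwd i)) fwdK comp_idr fwdK. Qed.

Definition iso_comp (C : category) (x y z : C) (i : iso x y) (j : iso y z) :
    iso x z :=
  Iso (iso_comp_subproof i j) (iso_comp_subproof (iso_inv j) (iso_inv i)).

Lemma iso_eq (C : category) (x y : C) (i j : iso x y) : fwd i = fwd j -> i = j.
Proof.
case: i => f g fg gf; case: j => f' g' fg' gf' /= E; subst f'.
have E : g = g' by rewrite -(comp_idl g) -gf' -compA fg comp_idr.
subst g'; by rewrite (proof_irrelevance _ fg fg') (proof_irrelevance _ gf gf').
Qed.

Lemma iso_monoL (C : category) (w x y : C) (i : iso w x) (s t : hom x y) :
  i ;; s = i ;; t -> s = t.
Proof. by move=> E; rewrite -(comp_idl s) -(bwdK i) -compA E compA bwdK comp_idl. Qed.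

Lemma iso_monoR (C : category) (x y z : C) (i : iso y z) (s t : hom x y) :
  s ;; i = t ;; i -> s = t.
Proof. by move=> E; rewrite -(comp_idr s) -(fwdK i) compA E -compA fwdK comp_idr. Qed.

Record bicategory := Bicategory {
  ob :> Type;
  hom1 : ob -> ob -> category;
  unit1 : forall a, hom1 a a;
  odot : forall a b c, hom1 a b -> hom1 b c -> hom1 a c;
  hcomp : forall a b c (f f' : hom1 a b) (g g' : hom1 b c),
    hom f f' -> hom g g' -> hom (odot f g) (odot f' g');
  assoc : forall a b c d (f : hom1 a b) (g : hom1 b c) (h : hom1 c d),
    iso (odot (odot f g) h) (odot f (odot g h));
  lunit : forall a b (f : hom1 a b), iso (odot (unit1 a) f) f;
  runit : forall a b (f : hom1 a b), iso (odot f (unit1 b)) f;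
  hcomp_id : forall a b c (f : hom1 a b) (g : hom1 b c),
    hcomp (idm f) (idm g) = idm (odot f g);
  hcomp_comp : forall a b c (f f' f'' : hom1 a b) (g g' g'' : hom1 b c)
    (s : hom f f') (s' : hom f' f'') (t : hom g g') (t' : hom g' g''),
    hcomp (s ;; s') (t ;; t') = hcomp s t ;; hcomp s' t';
  assoc_nat : forall a b c d (f f' : hom1 a b) (g g' : hom1 b c)
    (h h' : hom1 c d) (s : hom f f') (t : hom g g') (u : hom h h'),
    hcomp (hcomp s t) u ;; assoc f' g' h' = assoc f g h ;; hcomp s (hcomp t u);
  lunit_nat : forall a b (f f' : hom1 a b) (s : hom f f'),
    hcomp (idm (unit1 a)) s ;; lunit f' = lunit f ;; s;
  runit_nat : forall a b (f f' : hom1 a b) (s : hom f f'),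
    hcomp s (idm (unit1 b)) ;; runit f' = runit f ;; s;
  pentagon : forall a b c d e (f : hom1 a b) (g : hom1 b c) (h : hom1 c d)
    (k : hom1 d e),
    assoc (odot f g) h k ;; assoc f g (odot h k) =
    hcomp (assoc f g h) (idm k) ;; assoc f (odot g h) k
      ;; hcomp (idm f) (assoc g h k);
  triangle : forall a b c (f : hom1 a b) (g : hom1 b c),
    assoc f (unit1 b) g ;; hcomp (idm f) (lunit g) = hcomp (runit f) (idm g)
}.

Arguments hom1 {_} _ _.
Arguments unit1 {_} a.
Arguments odot {_ _ _ _} _ _.
Arguments hcomp {_ _ _ _ _ _ _ _} _ _.
Arguments assoc {_ _ _ _ _} f g h.
Arguments lunit {_ _ _} f.
Arguments runit {_ _ _} f.
Notation "M ⊙ N" := (odot M N) (at level 40, left associativity).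
Notation "s ** t" := (hcomp s t) (at level 40, left associativity).

Lemma hcomp_iso_subproof (B : bicategory) (a b c : B) (f f' : hom1 a b) (g g' : hom1 b c)
  (i : iso f f') (j : iso g g') : (i ** j) ;; (bwd i ** bwd j) = idm (f ⊙ g).
Proof. by rewrite -hcomp_comp !fwdK hcomp_id. Qed.

Definition hcomp_iso (B : bicategory) (a b c : B) (f f' : hom1 a b) (g g' : hom1 b c)
    (i : iso f f') (j : iso g g') : iso (f ⊙ g) (f' ⊙ g') :=
  Iso (hcomp_iso_subproof i j) (hcomp_iso_subproof (iso_inv i) (iso_inv j)).

(* Coherence by strictification, used in proofs only: [nf e X] is the left-nested form of X ⊙ e, and
   [nf2 t X] is the strictification of id_X ⊙ t, in which associators and
   unitors have become identities. *)
Section Coherence.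
Variable B : bicategory.

Inductive ex : B -> B -> Type :=
| EVar a b : hom1 a b -> ex a b
| EUnit a : ex a a
| EComp a b c : ex a b -> ex b c -> ex a c.

Fixpoint ev a b (e : ex a b) : hom1 a b :=
  match e with
  | EVar _ _ f => f
  | EUnit a => unit1 a
  | EComp _ _ _ e1 e2 => ev e1 ⊙ ev e2
  end.

Fixpoint nf a b (e : ex a b) z : hom1 z a -> hom1 z b :=
  match e in ex a b return hom1 z a -> hom1 z b with
  | EVar _ _ f => fun X => X ⊙ f
  | EUnit a => fun X => X
  | EComp _ _ _ e1 e2 => fun X => nf e2 (nf e1 X)
  end.

Fixpoint nfm a b (e : ex a b) z : forall (X Y : hom1 z a),
    hom X Y -> hom (nf e X) (nf e Y) :=
  match e in ex a b return forall (X Y : hom1 z a), hom X Y -> hom (nf e X) (nf e Y) with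
  | EVar _ _ f => fun X Y s => s ** idm f
  | EUnit a => fun X Y s => s
  | EComp _ _ _ e1 e2 => fun X Y s => nfm e2 (nfm e1 s)
  end.

Fixpoint can a b (e : ex a b) z : forall X : hom1 z a, iso (X ⊙ ev e) (nf e X) :=
  match e in ex a b return forall X : hom1 z a, iso (X ⊙ ev e) (nf e X) with
  | EVar _ _ f => fun X => iso_id _
  | EUnit a => fun X => runit X
  | EComp _ _ _ e1 e2 => fun X =>
      iso_comp (iso_comp (iso_inv (assoc X (ev e1) (ev e2)))
                         (hcomp_iso (can e1 X) (iso_id _)))
               (can e2 (nf e1 X))
  end.

Inductive tm : forall a b, ex a b -> ex a b -> Type :=
| TAtom a b (e e' : ex a b) : hom (ev e) (ev e') -> tm e e'
| TId a b (e : ex a b) : tm e e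
| TV a b (e1 e2 e3 : ex a b) : tm e1 e2 -> tm e2 e3 -> tm e1 e3
| TH a b c (e e' : ex a b) (g g' : ex b c) :
    tm e e' -> tm g g' -> tm (EComp e g) (EComp e' g')
| TA a b c d (e : ex a b) (f : ex b c) (g : ex c d) :
    tm (EComp (EComp e f) g) (EComp e (EComp f g))
| TAi a b c d (e : ex a b) (f : ex b c) (g : ex c d) :
    tm (EComp e (EComp f g)) (EComp (EComp e f) g)
| TL a b (e : ex a b) : tm (EComp (EUnit a) e) e
| TLi a b (e : ex a b) : tm e (EComp (EUnit a) e)
| TR a b (e : ex a b) : tm (EComp e (EUnit b)) e
| TRi a b (e : ex a b) : tm e (EComp e (EUnit b)).

Fixpoint ev2 a b (e e' : ex a b) (t : tm e e') : hom (ev e) (ev e') :=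
  match t with
  | TAtom _ _ _ _ s => s
  | TId _ _ e => idm (ev e)
  | TV _ _ _ _ _ t u => ev2 t ;; ev2 u
  | TH _ _ _ _ _ _ _ t u => ev2 t ** ev2 u
  | TA _ _ _ _ e f g => assoc (ev e) (ev f) (ev g)
  | TAi _ _ _ _ e f g => bwd (assoc (ev e) (ev f) (ev g))
  | TL _ _ e => lunit (ev e)
  | TLi _ _ e => bwd (lunit (ev e))
  | TR _ _ e => runit (ev e)
  | TRi _ _ e => bwd (runit (ev e))
  end.

(* Sealed so that rewriting does not look inside. *)
Fact at_sig a b (e e' : ex a b) (s : hom (ev e) (ev e')) z (X : hom1 z a) :
  {u : hom (nf e X) (nf e' X) | u = bwd (can e X) ;; (idm X ** s) ;; can e' X}.
Proof. by eexists. Qed.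

Definition at_ a b (e e' : ex a b) (s : hom (ev e) (ev e')) z (X : hom1 z a) :
  hom (nf e X) (nf e' X) := proj1_sig (at_sig s X).

Lemma at_E a b (e e' : ex a b) (s : hom (ev e) (ev e')) z (X : hom1 z a) :
  at_ s X = bwd (can e X) ;; (idm X ** s) ;; can e' X.
Proof. exact: proj2_sig (at_sig s X). Qed.

Fixpoint nf2 a b (e e' : ex a b) (t : tm e e') z :
    forall X : hom1 z a, hom (nf e X) (nf e' X) :=
  match t in @tm a b e e' return forall X : hom1 z a, hom (nf e X) (nf e' X) with
  | TAtom _ _ _ _ s => fun X => at_ s X
  | TId _ _ e => fun X => idm _
  | TV _ _ _ _ _ t u => fun X => nf2 t X ;; nf2 u X
  | TH _ _ _ e e' g g' t u => fun X => nfm g (nf2 t X) ;; nf2 u (nf e' X)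
  | TA _ _ _ _ e f g => fun X => idm _
  | TAi _ _ _ _ e f g => fun X => idm _
  | TL _ _ e => fun X => idm _
  | TLi _ _ e => fun X => idm _
  | TR _ _ e => fun X => idm _
  | TRi _ _ e => fun X => idm _
  end.

Lemma whisker_comp a b c (f f' f'' : @hom1 B a b) (g : hom1 b c)
  (s : hom f f') (t : hom f' f'') : (s ;; t) ** idm g = (s ** idm g) ;; (t ** idm g).
Proof. by rewrite -hcomp_comp comp_idl. Qed.

Lemma whiskel_comp a b c (f : @hom1 B a b) (g g' g'' : hom1 b c)
  (s : hom g g') (t : hom g' g'') : idm f ** (s ;; t) = (idm f ** s) ;; (idm f ** t).
Proof. by rewrite -hcomp_comp comp_idl. Qed.

Lemma hcomp_split a b c (f f' : @hom1 B a b) (g g' : hom1 b c)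
  (s : hom f f') (t : hom g g') : s ** t = (s ** idm g) ;; (idm f' ** t).
Proof. by rewrite -hcomp_comp comp_idl comp_idr. Qed.

Lemma hcomp_split' a b c (f f' : @hom1 B a b) (g g' : hom1 b c)
  (s : hom f f') (t : hom g g') : s ** t = (idm f ** t) ;; (s ** idm g').
Proof. by rewrite -hcomp_comp comp_idl comp_idr. Qed.

Lemma nfm_id a b (e : ex a b) z (X : hom1 z a) : nfm e (idm X) = idm _.
Proof.
by elim: e z X => //= [a1 b1 f z X|a1 b1 c1 e1 IH1 e2 IH2 z X]; rewrite ?hcomp_id ?IH1 ?IH2.
Qed.

Lemma nfm_comp a b (e : ex a b) z (X Y Z : hom1 z a) (s : hom X Y) (t : hom Y Z) :
  nfm e (s ;; t) = nfm e s ;; nfm e t.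
Proof.
by elim: e z X Y Z s t => //= [a1 b1 f z X Y Z s t|a1 b1 c1 e1 IH1 e2 IH2 z X Y Z s t];
   rewrite ?whisker_comp ?IH1 ?IH2.
Qed.

Lemma iso_swap (C : category) (w x y z : C) (i : iso w x) (j : iso y z)
  (s : hom w y) (t : hom x z) : s ;; j = i ;; t -> bwd i ;; s = t ;; bwd j.
Proof.
move=> E; apply: (iso_monoR (i := j)).
by rewrite -!compA E bwdK comp_idr compA bwdK comp_idl.
Qed.

Lemma assoc_nat' a b c d (f f' : @hom1 B a b) (g g' : hom1 b c)
    (h h' : hom1 c d) (s : hom f f') (t : hom g g') (u : hom h h') :
  bwd (assoc f g h) ;; ((s ** t) ** u) = (s ** (t ** u)) ;; bwd (assoc f' g' h').
Proof. by apply: iso_swap; apply: assoc_nat. Qed.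

Lemma can_nat a b (e : ex a b) z (X Y : hom1 z a) (s : hom X Y) :
  (s ** idm (ev e)) ;; can e Y = can e X ;; nfm e s.
Proof.
elim: e z X Y s => /= [a1 b1 f z X Y s|a1 z X Y s|a1 b1 c1 e1 IH1 e2 IH2 z X Y s].
- by rewrite comp_idl comp_idr.
- exact: runit_nat.
- rewrite -[idm (_ ⊙ _)]hcomp_id !compA -assoc_nat' -!compA; congr (_ ;; _).
  by rewrite !compA -whisker_comp IH1 whisker_comp -!compA IH2.
Qed.

Lemma runit_odot a b c (f : @hom1 B a b) (g : hom1 b c) :
  assoc f g (unit1 c) ;; (idm f ** runit g) = runit (f ⊙ g).
Proof.
have faith : forall (x y : hom1 a c) (s t : hom x y),
  s ** idm (unit1 c) = t ** idm (unit1 c) -> s = t.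
  by move=> x y s t E; apply: (iso_monoL (i := runit x)); rewrite -!runit_nat E.
apply: faith.
apply: (iso_monoR (i := assoc f g (unit1 c))).
rewrite whisker_comp -compA assoc_nat -[runit (f ⊙ g) ** _]triangle.
rewrite -triangle whiskel_comp.
rewrite !compA -pentagon -!compA; congr (_ ;; _).
by rewrite -assoc_nat hcomp_id.
Qed.

Lemma sound_assoc a b c d (e1 : ex a b) (e2 : ex b c) (e3 : ex c d) z
  (X : hom1 z a) :
  (idm X ** assoc (ev e1) (ev e2) (ev e3)) ;; can (EComp e1 (EComp e2 e3)) X =
  can (EComp (EComp e1 e2) e3) X.
Proof.
rewrite /= !whisker_comp !compA.
have E : (idm X ** assoc (ev e1) (ev e2) (ev e3))
    ;; bwd (assoc X (ev e1) (ev e2 ⊙ ev e3))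
    ;; bwd (assoc (X ⊙ ev e1) (ev e2) (ev e3)) =
  bwd (assoc X (ev e1 ⊙ ev e2) (ev e3))
    ;; (bwd (assoc X (ev e1) (ev e2)) ** idm (ev e3)).
  apply: (iso_monoR (i := assoc (X ⊙ ev e1) (ev e2) (ev e3))).
  rewrite -!compA bwdK comp_idr.
  apply: (iso_monoR (i := assoc X (ev e1) (ev e2 ⊙ ev e3))).
  rewrite -!compA bwdK comp_idr pentagon.
  apply: (iso_monoL (i := assoc X (ev e1 ⊙ ev e2) (ev e3))).
  rewrite !compA fwdK comp_idl.
  by rewrite -whisker_comp bwdK hcomp_id comp_idl.
rewrite -E -!compA; congr (_ ;; (_ ;; _)).
rewrite !compA; congr (_ ;; _); congr (_ ;; _).
by rewrite assoc_nat' hcomp_id.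
Qed.

Lemma sound_lunit a b (e : ex a b) z (X : hom1 z a) :
  (idm X ** lunit (ev e)) ;; can e X = can (EComp (EUnit a) e) X.
Proof. by rewrite /= -triangle !compA bwdK comp_idl. Qed.

Lemma sound_runit a b (e : ex a b) z (X : hom1 z a) :
  (idm X ** runit (ev e)) ;; can e X = can (EComp e (EUnit b)) X.
Proof.
by rewrite /= -compA runit_nat -runit_odot !compA bwdK comp_idl.
Qed.

Lemma sound_inv a b (e e' : ex a b) (i : iso (ev e) (ev e')) z (X : hom1 z a) w
    (p : hom (X ⊙ ev e) w) (q : hom (X ⊙ ev e') w) :
  (idm X ** i) ;; q = p -> (idm X ** bwd i) ;; p = q.
Proof. by move=> <-; rewrite compA -whiskel_comp bwdK hcomp_id comp_idl. Qed.

Lemma nf2_sound a b (e e' : ex a b) (t : tm e e') z (X : hom1 z a) :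
  (idm X ** ev2 t) ;; can e' X = can e X ;; nf2 t X.
Proof.
elim: t z X => /=.
- move=> a1 b1 e1 e2 s z X; rewrite at_E !compA fwdK comp_idl //.
- by move=> *; rewrite hcomp_id comp_idl comp_idr.
- move=> a1 b1 e1 e2 e3 t IHt u IHu z X.
  by rewrite whiskel_comp -compA IHu compA IHt -compA.
- move=> a1 b1 c1 e1 e2 g1 g2 t IHt u IHu z X.
  rewrite !compA -assoc_nat' -!compA; congr (_ ;; _).
  rewrite (compA (can g1 _)) -can_nat -(compA (_ ** _) (can g1 _)) -IHu !compA.
  congr (_ ;; _).
  by rewrite -!hcomp_comp !comp_idl !comp_idr IHt.
- by move=> a1 b1 c1 d1 e1 e2 e3 z X; rewrite comp_idr; exact: sound_assoc.
- move=> a1 b1 c1 d1 e1 e2 e3 z X; rewrite comp_idr.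
  exact: (sound_inv (e := EComp (EComp e1 e2) e3) (e' := EComp e1 (EComp e2 e3)))
    (sound_assoc _ _ _ _).
- by move=> a1 b1 e1 z X; rewrite comp_idr; exact: sound_lunit.
- move=> a1 b1 e1 z X; rewrite comp_idr.
  exact: (sound_inv (e := EComp (EUnit a1) e1) (e' := e1)) (sound_lunit _ _).
- by move=> a1 b1 e1 z X; rewrite comp_idr; exact: sound_runit.
- move=> a1 b1 e1 z X; rewrite comp_idr.
  exact: (sound_inv (e := EComp e1 (EUnit b1)) (e' := e1)) (sound_runit _ _).
Qed.

Lemma nf2_eq a b (e e' : ex a b) (t t' : tm e e') :
  ev2 t = ev2 t' -> forall z (X : hom1 z a), nf2 t X = nf2 t' X.
Proof.
by move=> E z X; apply: (iso_monoL (i := can e X)); rewrite -!nf2_sound E.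
Qed.

Lemma whiskel_faithful a b (f g : @hom1 B a b) (s t : hom f g) :
  idm (unit1 a) ** s = idm (unit1 a) ** t -> s = t.
Proof. by move=> E; apply: (iso_monoL (i := lunit f)); rewrite -!lunit_nat E. Qed.

Lemma ev2_eq a b (e e' : ex a b) (t t' : tm e e') :
  (forall z (X : hom1 z a), nf2 t X = nf2 t' X) -> ev2 t = ev2 t'.
Proof.
move=> E; apply: whiskel_faithful; apply: (iso_monoR (i := can e' (unit1 a))).
by rewrite !nf2_sound E.
Qed.

Lemma nf2_nat a b (e e' : ex a b) (t : tm e e') z (X Y : hom1 z a) (s : hom X Y) :
  nfm e s ;; nf2 t Y = nf2 t X ;; nfm e' s.
Proof.
apply: (iso_monoL (i := can e X)).
rewrite !compA -can_nat -nf2_sound -!compA -can_nat -nf2_sound !compA.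
by rewrite -!hcomp_comp !comp_idl !comp_idr.
Qed.

Lemma at_nat a b (e e' : ex a b) (u : hom (ev e) (ev e')) z (X Y : hom1 z a)
  (s : hom X Y) : nfm e s ;; at_ u Y = at_ u X ;; nfm e' s.
Proof. exact: (nf2_nat (TAtom u)). Qed.
End Coherence.

Ltac rx f :=
  lazymatch f with
  | ?g ⊙ ?h => let a := rx g in let b := rx h in constr:(EComp a b)
  | unit1 ?a => constr:(EUnit a)
  | _ => constr:(EVar f)
  end.

Ltac rt t :=
  lazymatch t with
  | idm ?f => let e := rx f in constr:(TId e)
  | ?s ;; ?u => let a := rt s in let b := rt u in constr:(TV a b)
  | ?s ** ?u => let a := rt s in let b := rt u in constr:(TH a b)
  | fwd (assoc ?f ?g ?h) =>
      let a := rx f in let b := rx g in let c := rx h in constr:(TA a b c)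
  | bwd (assoc ?f ?g ?h) =>
      let a := rx f in let b := rx g in let c := rx h in constr:(TAi a b c)
  | fwd (lunit ?f) => let a := rx f in constr:(TL a)
  | bwd (lunit ?f) => let a := rx f in constr:(TLi a)
  | fwd (runit ?f) => let a := rx f in constr:(TR a)
  | bwd (runit ?f) => let a := rx f in constr:(TRi a)
  | _ => lazymatch type of t with
         | @hom _ ?f ?g => let a := rx f in let b := rx g in
             constr:(@TAtom _ _ _ a b t)
         end
  end.

Ltac snf := rewrite ?(whisker_comp, hcomp_id, comp_idl, comp_idr, compA).

(* [strict] reduces an equation of 2-cells to its strictification; [strictify]
   does the same to a hypothesis, and [inter u] adds the interchange law for u. *)
Ltac strict :=
  lazymatch goal with
  | |- @eq _ ?l ?r =>
      let a := rt l in let b := rt r in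
      refine (@ev2_eq _ _ _ _ _ a b _);
      let z := fresh "z" in let X := fresh "X" in
      intros z X; cbn [nf2 nf nfm ev]; snf
  end.

Ltac strictify H :=
  lazymatch type of H with
  | @eq _ ?l ?r =>
      let a := rt l in let b := rt r in
      let h := constr:(fun dom_ pre_ => ltac:(
        let q := fresh "q" in
        pose proof (@nf2_eq _ _ _ _ _ a b H dom_ pre_) as q;
        cbn [nf2 nf nfm ev] in q; move: q; snf; let r := fresh "r" in
        intro r; exact r)) in
      let k := fresh in
      pose proof h as k; clear H; rename k into H
  end.


Ltac seta u X h :=
  lazymatch type of u with
  | @hom _ ?f ?g =>
      let a := rx f in let b := rx g in
      let t := constr:(@at_ _ _ _ a b u _ X) in
      let t' := eval cbn [nf nfm ev] in t in
      set (h := t')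
  end.

Ltac inter u :=
  lazymatch type of u with
  | @hom _ ?f ?g =>
      let a := rx f in let b := rx g in
      let h := fresh "N" in
      pose proof (@at_nat _ _ _ a b u) as h; cbn [nf nfm ev] in h
  end.

Record pseudofunctor (A B : bicategory) := Pseudofunctor {
  pf0 :> A -> B;
  pf1 : forall a b, hom1 a b -> hom1 (pf0 a) (pf0 b);
  pf2 : forall a b (f g : hom1 a b), hom f g -> hom (pf1 f) (pf1 g);
  phi : forall a b c (f : hom1 a b) (g : hom1 b c),
    iso (pf1 f ⊙ pf1 g) (pf1 (f ⊙ g));
  phi0 : forall a, iso (unit1 (pf0 a)) (pf1 (unit1 a));
  pf2_id : forall a b (f : hom1 a b), pf2 (idm f) = idm (pf1 f);
  pf2_comp : forall a b (f g h : hom1 a b) (s : hom f g) (t : hom g h),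
    pf2 (s ;; t) = pf2 s ;; pf2 t;
  phi_nat : forall a b c (f f' : hom1 a b) (g g' : hom1 b c)
    (s : hom f f') (t : hom g g'),
    (pf2 s ** pf2 t) ;; phi f' g' = phi f g ;; pf2 (s ** t);
  phi_assoc : forall a b c d (f : hom1 a b) (g : hom1 b c) (h : hom1 c d),
    (phi f g ** idm (pf1 h)) ;; phi (f ⊙ g) h ;; pf2 (assoc f g h) =
    assoc (pf1 f) (pf1 g) (pf1 h) ;; (idm (pf1 f) ** phi g h) ;; phi f (g ⊙ h);
  phi_lunit : forall a b (f : hom1 a b),
    (phi0 a ** idm (pf1 f)) ;; phi (unit1 a) f ;; pf2 (lunit f) = lunit (pf1 f);
  phi_runit : forall a b (f : hom1 a b),
    (idm (pf1 f) ** phi0 b) ;; phi f (unit1 b) ;; pf2 (runit f) = runit (pf1 f)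
}.

Arguments pf1 {A B} F {a b} f : rename.
Arguments pf2 {A B} F {a b f g} s : rename.
Arguments phi {A B} F {a b c} f g : rename.
Arguments phi0 {A B} F a : rename.

Lemma pf2_iso_subproof A B (F : pseudofunctor A B) a b (f g : @hom1 A a b)
  (i : iso f g) : pf2 F i ;; pf2 F (bwd i) = idm (pf1 F f).
Proof. by rewrite -pf2_comp fwdK pf2_id. Qed.

Definition pf2_iso A B (F : pseudofunctor A B) a b (f g : @hom1 A a b)
    (i : iso f g) : iso (pf1 F f) (pf1 F g) :=
  Iso (pf2_iso_subproof F i) (pf2_iso_subproof F (iso_inv i)).

Section PfComp.
Variables (A B C : bicategory) (F : pseudofunctor A B) (G : pseudofunctor B C).

Definition pf_comp : pseudofunctor A C.
Proof.
refine (@Pseudofunctor A C (fun a => G (F a)) (fun a b f => pf1 G (pf1 F f))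
  (fun a b f g s => pf2 G (pf2 F s))
  (fun a b c f g => iso_comp (phi G (pf1 F f) (pf1 F g)) (pf2_iso G (phi F f g)))
  (fun a => iso_comp (phi0 G (F a)) (pf2_iso G (phi0 F a)))
  _ _ _ _ _ _).
- by move=> a b f; rewrite !pf2_id.
- by move=> a b f g h s t; rewrite !pf2_comp.
- move=> a b c f f' g g' s t /=.
  by rewrite compA phi_nat -!compA -!pf2_comp phi_nat.
- move=> a b c d f g h /=.
  rewrite whisker_comp -(pf2_id G) -!compA (compA (pf2 G _ ** pf2 G _)) phi_nat.
  rewrite -!compA -!pf2_comp (compA (phi F _ _ ** _)) phi_assoc.
  rewrite !pf2_comp pf2_id !compA phi_assoc -!compA; congr (_ ;; _).
  rewrite whiskel_comp -!compA; congr (_ ;; _).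
  by rewrite -(pf2_id G (pf1 F f)) !compA phi_nat.
- move=> a b f /=.
  rewrite whisker_comp -(pf2_id G) -!compA (compA (pf2 G _ ** pf2 G _)) phi_nat.
  by rewrite -!compA -!pf2_comp (compA (phi0 F _ ** _)) phi_lunit pf2_id compA phi_lunit.
- move=> a b f /=.
  rewrite whiskel_comp -(pf2_id G) -!compA (compA (pf2 G _ ** pf2 G _)) phi_nat.
  by rewrite -!compA -!pf2_comp (compA (_ ** fwd (phi0 F _))) phi_runit pf2_id compA phi_runit.
Defined.
End PfComp.

(* Transformations are split into data and laws because modifications, and the
   composites they are taken between, only involve the data. *)
Record trans_data A B (F G : pseudofunctor A B) := TransData {
  tr1 :> forall a, hom1 (F a) (G a);
  tr2 : forall a b (f : hom1 a b), iso (tr1 a ⊙ pf1 G f) (pf1 F f ⊙ tr1 b)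
}.

Arguments tr2 {A B F G} z {a b} f : rename.

Record strong_trans A B (F G : pseudofunctor A B) := StrongTrans {
  st_data :> trans_data F G;
  st_nat : forall a b (f g : hom1 a b) (s : hom f g),
    (idm (st_data a) ** pf2 G s) ;; tr2 st_data g =
    tr2 st_data f ;; (pf2 F s ** idm (st_data b));
  st_odot : forall a b c (f : hom1 a b) (g : hom1 b c),
    (idm (st_data a) ** phi G f g) ;; tr2 st_data (f ⊙ g) =
    bwd (assoc _ _ _) ;; (tr2 st_data f ** idm (pf1 G g)) ;; assoc _ _ _
      ;; (idm (pf1 F f) ** tr2 st_data g) ;; bwd (assoc _ _ _)
      ;; (phi F f g ** idm (st_data c));
  st_unit : forall a,
    (idm (st_data a) ** phi0 G a) ;; tr2 st_data (unit1 a) =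
    runit (st_data a) ;; bwd (lunit (st_data a)) ;; (phi0 F a ** idm (st_data a))
}.

Definition trans_comp A B (F G H : pseudofunctor A B) (z : trans_data F G)
    (w : trans_data G H) : trans_data F H :=
  @TransData A B F H (fun a => z a ⊙ w a) (fun a b f =>
    iso_comp (iso_comp (iso_comp (iso_comp
      (assoc (z a) (w a) (pf1 H f))
      (hcomp_iso (iso_id (z a)) (tr2 w f)))
      (iso_inv (assoc (z a) (pf1 G f) (w b))))
      (hcomp_iso (tr2 z f) (iso_id (w b))))
      (assoc (pf1 F f) (z b) (w b))).

Definition trans_whisker A B C (K : pseudofunctor A B) (F G : pseudofunctor B C)
    (z : trans_data F G) : trans_data (pf_comp K F) (pf_comp K G) :=
  @TransData A C (pf_comp K F) (pf_comp K G) (fun a => z (K a))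
    (fun a b f => tr2 z (pf1 K f)).

Record modification A B (F G : pseudofunctor A B) (z w : trans_data F G) :=
  Modification {
    md :> forall a, hom (z a) (w a);
    md_nat : forall a b (f : hom1 a b),
      (md a ** idm (pf1 G f)) ;; tr2 w f = tr2 z f ;; (idm (pf1 F f) ** md b)
  }.

Section Duals.
Variable B : bicategory.

Record right_dual (a b : B) (M : hom1 a b) := RightDual {
  dob : hom1 b a;
  eta : hom (unit1 a) (M ⊙ dob);
  eps : hom (dob ⊙ M) (unit1 b);
  tri1 : bwd (lunit M) ;; (eta ** idm M) ;; assoc M dob M ;; (idm M ** eps)
           ;; runit M = idm M;
  tri2 : bwd (runit dob) ;; (idm dob ** eta) ;; bwd (assoc dob M dob)
           ;; (eps ** idm dob) ;; lunit dob = idm dob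
}.

Definition dualizable (a b : B) (M : hom1 a b) : Prop := inhabited (right_dual M).

(* Dualizability is a property; [trace_with_indep] shows that the trace does not
   depend on the dual chosen here. *)
Definition chosen_dual (a b : B) (M : hom1 a b) (h : dualizable M) : right_dual M :=
  epsilon h (fun _ => True).

Definition dual_unit (a : B) : right_dual (unit1 a).
Proof.
refine (@RightDual a a (unit1 a) (unit1 a) (bwd (lunit (unit1 a))) (lunit (unit1 a)) _ _).
- by strict; snf.
- by strict; snf.
Defined.

Definition dual_comp (a b c : B) (M : hom1 a b) (N : hom1 b c)
  (dM : right_dual M) (dN : right_dual N) : right_dual (M ⊙ N).
Proof.
refine (@RightDual a c (M ⊙ N) (dob dN ⊙ dob dM)
  (eta dM ;; (bwd (runit M) ** idm _) ;; ((idm M ** eta dN) ** idm _)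
     ;; (bwd (assoc _ _ _) ** idm _) ;; assoc (M ⊙ N) _ _)
  (assoc _ _ _ ;; (idm _ ** bwd (assoc _ _ _)) ;; (idm _ ** (eps dM ** idm _))
     ;; (idm _ ** lunit N) ;; eps dN) _ _).
- case: dM => dM hM eM t1 t2; case: dN => dN hN eN s1 s2 /=.
  strictify t1; strictify t2; strictify s1; strictify s2.
  inter hM; inter hN; inter eM; inter eN.
  strict.
  rewrite -(compA _ (_ ** idm dM ** idm M ** _)) -(whisker_comp _ (_ ** idm dM ** _)).
  rewrite N2 whisker_comp !compA.
  by rewrite -(whisker_comp _ (_ ** idm M)) t1; snf; rewrite s1.
- case: dM => dM hM eM t1 t2; case: dN => dN hN eN s1 s2 /=.
  strictify t1; strictify t2; strictify s1; strictify s2.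
  inter hM; inter hN; inter eM; inter eN.
  strict.
  rewrite -(compA _ (_ ** idm dM) (_ ** idm N ** idm dN ** idm dM)).
  rewrite -(whisker_comp _ _ (_ ** idm N ** idm dN)) -N1 whisker_comp !compA t2; snf.
  by rewrite -whisker_comp s2; snf.
Defined.

End Duals.


Section PfDual.
Variables (A B : bicategory) (F : pseudofunctor A B).

Lemma phi_nat' (a b c : A) (f f' : hom1 a b) (g g' : hom1 b c)
    (s : hom f f') (t : hom g g') :
  bwd (phi F f g) ;; (pf2 F s ** pf2 F t) = pf2 F (s ** t) ;; bwd (phi F f' g').
Proof. exact: iso_swap (phi_nat _ _ _). Qed.

Lemma phi_assoc' (a b c d : A) (f : hom1 a b) (g : hom1 b c) (h : hom1 c d) :
  bwd (phi F (f ⊙ g) h) ;; (bwd (phi F f g) ** idm (pf1 F h)) ;; assoc _ _ _ =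
  pf2 F (assoc f g h) ;; bwd (phi F f (g ⊙ h)) ;; (idm (pf1 F f) ** bwd (phi F g h)).
Proof.
apply: (iso_monoL (i := iso_comp (hcomp_iso (phi F f g) (iso_id _)) (phi F (f ⊙ g) h))).
rewrite /= !compA -(compA _ (fwd (phi F _ _))) fwdK comp_idr.
rewrite -whisker_comp fwdK hcomp_id comp_idl phi_assoc.
by rewrite -(compA _ (fwd _) (bwd _)) fwdK comp_idr -compA -whiskel_comp fwdK; snf.
Qed.

Lemma phi_assoc'' (a b c d : A) (f : hom1 a b) (g : hom1 b c) (h : hom1 c d) :
  bwd (phi F f (g ⊙ h)) ;; (idm (pf1 F f) ** bwd (phi F g h)) ;; bwd (assoc _ _ _) =
  pf2 F (bwd (assoc f g h)) ;; bwd (phi F (f ⊙ g) h)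
    ;; (bwd (phi F f g) ** idm (pf1 F h)).
Proof.
apply: (iso_monoR (i := assoc _ _ _)).
rewrite -!compA bwdK comp_idr (compA (bwd (phi F _ _)) (_ ** idm _)) phi_assoc'.
by rewrite !compA -(pf2_comp F) bwdK pf2_id comp_idl.
Qed.

Lemma phi_lunit' (a b : A) (f : hom1 a b) :
  bwd (lunit (pf1 F f)) ;; (phi0 F a ** idm (pf1 F f)) =
  pf2 F (bwd (lunit f)) ;; bwd (phi F (unit1 a) f).
Proof.
apply: (iso_monoL (i := lunit (pf1 F f))); rewrite !compA fwdK comp_idl.
rewrite -phi_lunit -(compA _ (pf2 F _) (pf2 F _)) -(pf2_comp F) fwdK pf2_id comp_idr.
by rewrite -compA fwdK comp_idr.
Qed.

Lemma phi_runit' (a b : A) (f : hom1 a b) :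
  bwd (runit (pf1 F f)) ;; (idm (pf1 F f) ** phi0 F b) =
  pf2 F (bwd (runit f)) ;; bwd (phi F f (unit1 b)).
Proof.
apply: (iso_monoL (i := runit (pf1 F f))); rewrite !compA fwdK comp_idl.
rewrite -phi_runit -(compA _ (pf2 F _) (pf2 F _)) -(pf2_comp F) fwdK pf2_id comp_idr.
by rewrite -compA fwdK comp_idr.
Qed.

Lemma phi_lunit'' (a b : A) (f : hom1 a b) :
  bwd (phi F (unit1 a) f) ;; (bwd (phi0 F a) ** idm (pf1 F f)) ;; lunit (pf1 F f) =
  pf2 F (lunit f).
Proof.
rewrite -phi_lunit !compA -(compA (bwd (phi F _ _))) -whisker_comp bwdK hcomp_id.
by rewrite comp_idr bwdK comp_idl.
Qed.

Lemma phi_runit'' (a b : A) (f : hom1 a b) :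
  bwd (phi F f (unit1 b)) ;; (idm (pf1 F f) ** bwd (phi0 F b)) ;; runit (pf1 F f) =
  pf2 F (runit f).
Proof.
rewrite -phi_runit !compA -(compA (bwd (phi F _ _))) -whiskel_comp bwdK hcomp_id.
by rewrite comp_idr bwdK comp_idl.
Qed.

Definition pf_dual (a b : A) (M : hom1 a b) (d : right_dual M) :
  right_dual (pf1 F M).
Proof.
refine (@RightDual B (F a) (F b) (pf1 F M) (pf1 F (dob d))
  (phi0 F a ;; pf2 F (eta d) ;; bwd (phi F _ _))
  (phi F _ _ ;; pf2 F (eps d) ;; bwd (phi0 F b)) _ _).
- rewrite !whisker_comp !whiskel_comp !compA phi_lunit'.
  rewrite -(compA (pf2 F (bwd _))) -{1}(pf2_id F M) phi_nat' !compA.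
  rewrite -(compA _ (bwd (phi F _ _)) (_ ** idm _)) -(compA _ _ (fwd (assoc _ _ _))).
  rewrite phi_assoc' !compA -(compA _ _ (_ ** fwd (phi F _ _))).
  rewrite -whiskel_comp bwdK hcomp_id comp_idr.
  rewrite -{1}(pf2_id F M) -(compA _ (bwd (phi F _ _)) (_ ** pf2 F (eps d))) phi_nat'.
  rewrite !compA -(compA _ (bwd (phi F _ _)) (_ ** bwd (phi0 F b))).
  rewrite -(compA _ (_ ;; _) (fwd (runit _))) phi_runit''.
  by rewrite -!(pf2_comp F) tri1 pf2_id.
- rewrite !whisker_comp !whiskel_comp !compA phi_runit'.
  rewrite -(compA (pf2 F (bwd _))) -{1}(pf2_id F (dob d)) phi_nat' !compA.
  rewrite -(compA _ (bwd (phi F _ _)) (idm _ ** _)) -(compA _ _ (bwd (assoc _ _ _))).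
  rewrite phi_assoc'' !compA -(compA _ _ (fwd (phi F _ _) ** _)).
  rewrite -whisker_comp bwdK hcomp_id comp_idr.
  rewrite -{1}(pf2_id F (dob d)) -(compA _ (bwd (phi F _ _)) (pf2 F (eps d) ** _)) phi_nat'.
  rewrite !compA -(compA _ (bwd (phi F _ _)) (bwd (phi0 F b) ** _)).
  rewrite -(compA _ (_ ;; _) (fwd (lunit _))) phi_lunit''.
  by rewrite -!(pf2_comp F) tri2 pf2_id.
Defined.

Lemma pf_dualizable (a b : A) (M : hom1 a b) : dualizable M -> dualizable (pf1 F M).
Proof. by move=> [d]; split; exact: pf_dual. Qed.

End PfDual.

Section Lambda.
Variable B : bicategory.

Record endo := Endo { e0 : B; e1 : hom1 e0 e0 }.

Record lhom1 (P Q : endo) := LHom1 {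
  lm : hom1 (e0 P) (e0 Q);
  ldual : dualizable lm;
  lpsi : hom (e1 P ⊙ lm) (lm ⊙ e1 Q)
}.

Record lhom2 (P Q : endo) (f g : lhom1 P Q) := LHom2 {
  l2 : iso (lm f) (lm g);
  l2_eq : (idm (e1 P) ** l2) ;; lpsi g = lpsi f ;; (l2 ** idm (e1 Q))
}.

Lemma lhom2_eq P Q (f g : lhom1 P Q) (s t : lhom2 f g) :
  fwd (l2 s) = fwd (l2 t) -> s = t.
Proof.
case: s => s Es; case: t => t Et /= E; have {}E := iso_eq E; subst t.
by rewrite (proof_irrelevance _ Es Et).
Qed.

Lemma linv_subproof P Q (f g : lhom1 P Q) (s : lhom2 f g) :
  (idm (e1 P) ** iso_inv (l2 s)) ;; lpsi f =
  lpsi g ;; (iso_inv (l2 s) ** idm (e1 Q)).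
Proof.
apply: (iso_monoR (i := hcomp_iso (l2 s) (iso_id (e1 Q)))) => /=.
rewrite -compA -(l2_eq s) compA -whiskel_comp bwdK hcomp_id comp_idl.
by rewrite -compA -whisker_comp bwdK hcomp_id comp_idr.
Qed.

Definition linv P Q (f g : lhom1 P Q) (s : lhom2 f g) : lhom2 g f :=
  LHom2 (linv_subproof s).

Definition lid2 P Q (f : lhom1 P Q) : lhom2 f f.
Proof. by refine (@LHom2 P Q f f (iso_id (lm f)) _); rewrite /=; snf. Defined.

Definition lcomp2 P Q (f g h : lhom1 P Q) (s : lhom2 f g) (t : lhom2 g h) :
  lhom2 f h.
Proof.
refine (@LHom2 P Q f h (iso_comp (l2 s) (l2 t)) _).
by rewrite /= whiskel_comp whisker_comp -compA l2_eq !compA l2_eq.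
Defined.

Definition lcat (P Q : endo) : category.
Proof.
refine (@Category (lhom1 P Q) (@lhom2 P Q) (@lid2 P Q) (@lcomp2 P Q) _ _ _);
  move=> *; apply: lhom2_eq => /=; by snf.
Defined.

Definition liso P Q (f g : lcat P Q) (s : lhom2 f g) : iso f g.
Proof.
refine (@Iso (lcat P Q) f g s (linv s) _ _); apply: lhom2_eq; rewrite /=.
- exact: fwdK.
- exact: bwdK.
Defined.

Definition lunit1 (P : endo) : lhom1 P P :=
  @LHom1 P P (unit1 (e0 P)) (inhabits (dual_unit (e0 P)))
    (runit (e1 P) ;; bwd (lunit (e1 P))).

Lemma dualizable_odot (a b c : B) (M : hom1 a b) (N : hom1 b c) :
  dualizable M -> dualizable N -> dualizable (M ⊙ N).
Proof. by move=> [dM] [dN]; split; exact: dual_comp. Qed.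

Definition lodot (P Q T : endo) (f : lhom1 P Q) (g : lhom1 Q T) : lhom1 P T :=
  @LHom1 P T (lm f ⊙ lm g) (dualizable_odot (ldual f) (ldual g))
    (bwd (assoc (e1 P) (lm f) (lm g))
      ;; (lpsi f ** idm (lm g))
      ;; assoc (lm f) (e1 Q) (lm g)
      ;; (idm (lm f) ** lpsi g)
      ;; bwd (assoc (lm f) (lm g) (e1 T))).

Lemma lhcomp_subproof (P Q T : endo) (f f' : lhom1 P Q) (g g' : lhom1 Q T)
  (s : lhom2 f f') (t : lhom2 g g') :
  (idm (e1 P) ** hcomp_iso (l2 s) (l2 t)) ;; lpsi (lodot f' g') =
  lpsi (lodot f g) ;; (hcomp_iso (l2 s) (l2 t) ** idm (e1 T)).
Proof.
rewrite /=.
have E1 := l2_eq s; have E2 := l2_eq t.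
strictify E1; strictify E2; inter (fwd (l2 s)); inter (fwd (l2 t)).
inter (lpsi f'); inter (lpsi g).
strict.
rewrite -(compA _ _ (_ ** idm (lm g'))) -N0 !compA -whisker_comp E1 whisker_comp.
by rewrite -!compA E2 (compA (_ ** idm (e1 Q) ** _)) N2 !compA.
Qed.

Definition lhcomp (P Q T : endo) (f f' : lhom1 P Q) (g g' : lhom1 Q T)
    (s : lhom2 f f') (t : lhom2 g g') : lhom2 (lodot f g) (lodot f' g') :=
  @LHom2 P T (lodot f g) (lodot f' g') (hcomp_iso (l2 s) (l2 t)) (lhcomp_subproof s t).

Lemma lassoc_subproof (P Q T R : endo) (f : lhom1 P Q) (g : lhom1 Q T)
  (h : lhom1 T R) :
  (idm (e1 P) ** assoc (lm f) (lm g) (lm h)) ;; lpsi (lodot f (lodot g h)) =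
  lpsi (lodot (lodot f g) h) ;; (assoc (lm f) (lm g) (lm h) ** idm (e1 R)).
Proof. by rewrite /=; strict. Qed.

Definition lassoc (P Q T R : endo) (f : lhom1 P Q) (g : lhom1 Q T)
    (h : lhom1 T R) : lhom2 (lodot (lodot f g) h) (lodot f (lodot g h)) :=
  @LHom2 P R (lodot (lodot f g) h) (lodot f (lodot g h)) (assoc (lm f) (lm g) (lm h))
    (lassoc_subproof f g h).

Lemma llunit_subproof (P Q : endo) (f : lhom1 P Q) :
  (idm (e1 P) ** lunit (lm f)) ;; lpsi f =
  lpsi (lodot (lunit1 P) f) ;; (lunit (lm f) ** idm (e1 Q)).
Proof. by rewrite /=; strict. Qed.

Definition llunit (P Q : endo) (f : lhom1 P Q) : lhom2 (lodot (lunit1 P) f) f :=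
  @LHom2 P Q (lodot (lunit1 P) f) f (lunit (lm f)) (llunit_subproof f).

Lemma lrunit_subproof (P Q : endo) (f : lhom1 P Q) :
  (idm (e1 P) ** runit (lm f)) ;; lpsi f =
  lpsi (lodot f (lunit1 Q)) ;; (runit (lm f) ** idm (e1 Q)).
Proof. by rewrite /=; strict. Qed.

Definition lrunit (P Q : endo) (f : lhom1 P Q) : lhom2 (lodot f (lunit1 Q)) f :=
  @LHom2 P Q (lodot f (lunit1 Q)) f (runit (lm f)) (lrunit_subproof f).

Definition Lambda : bicategory.
Proof.
refine (@Bicategory endo lcat lunit1 lodot lhcomp
  (fun P Q T R f g h => liso (lassoc f g h))
  (fun P Q f => liso (llunit f)) (fun P Q f => liso (lrunit f))
  _ _ _ _ _ _ _); move=> *; apply: lhom2_eq => /=.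
- exact: hcomp_id.
- exact: hcomp_comp.
- exact: assoc_nat.
- exact: lunit_nat.
- exact: runit_nat.
- exact: pentagon.
- exact: triangle.
Defined.
End Lambda.

Section LambdaFunctor.
Variables (A B : bicategory) (F : pseudofunctor A B).

Definition lpf0 (P : Lambda A) : Lambda B := Endo (pf1 F (e1 P)).

Definition lpf1 (P Q : Lambda A) (f : hom1 P Q) : hom1 (lpf0 P) (lpf0 Q) :=
  @LHom1 B (lpf0 P) (lpf0 Q) (pf1 F (lm f)) (pf_dualizable F (ldual f))
    (phi F (e1 P) (lm f) ;; pf2 F (lpsi f) ;; bwd (phi F (lm f) (e1 Q))).

Lemma lpf2_subproof (P Q : Lambda A) (f g : hom1 P Q) (s : hom f g) :
  (idm (pf1 F (e1 P)) ** pf2_iso F (l2 s)) ;; lpsi (lpf1 g) =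
  lpsi (lpf1 f) ;; (pf2_iso F (l2 s) ** idm (pf1 F (e1 Q))).
Proof.
rewrite /= -!(pf2_id F) !compA phi_nat -(compA _ (pf2 F _) (pf2 F _)) -(pf2_comp F) l2_eq.
by rewrite -(compA _ (bwd _)) phi_nat' pf2_comp !compA.
Qed.

Definition lpf2 (P Q : Lambda A) (f g : hom1 P Q) (s : hom f g) :
    hom (lpf1 f) (lpf1 g) :=
  @LHom2 B (lpf0 P) (lpf0 Q) (lpf1 f) (lpf1 g) (pf2_iso F (l2 s)) (lpf2_subproof s).

Lemma lphi_subproof (P Q T : Lambda A) (f : hom1 P Q) (g : hom1 Q T) :
  (idm (pf1 F (e1 P)) ** phi F (lm f) (lm g)) ;; lpsi (lpf1 (f ⊙ g)) =
  lpsi (lpf1 f ⊙ lpf1 g) ;; (phi F (lm f) (lm g) ** idm (pf1 F (e1 T))).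
Proof.
have L1 : (idm (pf1 F (e1 P)) ** phi F (lm f) (lm g)) ;; phi F _ _
    ;; pf2 F (bwd (assoc (e1 P) (lm f) (lm g))) =
  bwd (assoc _ _ _) ;; (phi F _ _ ** idm (pf1 F (lm g))) ;; phi F _ (lm g).
  apply: (iso_monoR (i := pf2_iso F (assoc (e1 P) (lm f) (lm g)))).
  rewrite /= -(compA _ (pf2 F _)) -(pf2_comp F) bwdK pf2_id comp_idr.
  by rewrite -!compA (compA (_ ** idm _)) phi_assoc !compA bwdK comp_idl.
have L3 : phi F (lm f ⊙ e1 Q) (lm g) ;; pf2 F (assoc (lm f) (e1 Q) (lm g)) =
  (bwd (phi F _ _) ** idm (pf1 F (lm g))) ;; assoc _ _ _
    ;; (idm (pf1 F (lm f)) ** phi F _ _) ;; phi F _ _.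
  rewrite -!compA (compA (fwd (assoc _ _ _))) -phi_assoc !compA.
  by rewrite -whisker_comp bwdK hcomp_id comp_idl.
have L5 : phi F (lm f) (lm g ⊙ e1 T) ;; pf2 F (bwd (assoc (lm f) (lm g) (e1 T)))
    ;; bwd (phi F (lm f ⊙ lm g) (e1 T)) =
  (idm (pf1 F (lm f)) ** bwd (phi F (lm g) (e1 T))) ;; bwd (assoc _ _ _)
    ;; (phi F (lm f) (lm g) ** idm (pf1 F (e1 T))).
  apply: (iso_monoL (i := iso_inv (phi F (lm f) (lm g ⊙ e1 T)))) => /=.
  rewrite !compA phi_assoc'' bwdK comp_idl -(compA _ (bwd (phi F _ _) ** _)).
  by rewrite -whisker_comp bwdK hcomp_id comp_idr.
rewrite /= !pf2_comp !whisker_comp !whiskel_comp !compA L1.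
rewrite -(compA _ (fwd (phi F _ _))) -phi_nat pf2_id.
rewrite !compA -(compA _ (fwd (phi F _ _))) L3.
rewrite !compA -(compA _ (fwd (phi F _ _))) -phi_nat pf2_id.
by rewrite !compA -(compA _ (fwd (phi F _ _))) -(compA _ (_ ;; _) (bwd _)) L5 !compA.
Qed.

Definition lphi (P Q T : Lambda A) (f : hom1 P Q) (g : hom1 Q T) :
    hom (lpf1 f ⊙ lpf1 g) (lpf1 (f ⊙ g)) :=
  @LHom2 B (lpf0 P) (lpf0 T) (lpf1 f ⊙ lpf1 g) (lpf1 (f ⊙ g))
    (phi F (lm f) (lm g)) (lphi_subproof f g).

Lemma lphi0_subproof (P : Lambda A) :
  (idm (pf1 F (e1 P)) ** phi0 F (e0 P)) ;; lpsi (lpf1 (unit1 P)) =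
  lpsi (unit1 (lpf0 P)) ;; (phi0 F (e0 P) ** idm (pf1 F (e1 P))).
Proof.
rewrite /= !pf2_comp !compA phi_runit -!compA; congr (_ ;; _).
by rewrite phi_lunit'.
Qed.

Definition lphi0 (P : Lambda A) : hom (unit1 (lpf0 P)) (lpf1 (unit1 P)) :=
  @LHom2 B (lpf0 P) (lpf0 P) (unit1 (lpf0 P)) (lpf1 (unit1 P))
    (phi0 F (e0 P)) (lphi0_subproof P).

Definition lambda_pf : pseudofunctor (Lambda A) (Lambda B).
Proof.
refine (@Pseudofunctor (Lambda A) (Lambda B) lpf0 lpf1 lpf2
  (fun P Q T f g => liso (lphi f g)) (fun P => liso (lphi0 P)) _ _ _ _ _ _);
  move=> *; apply: lhom2_eq => /=.
- exact: pf2_id.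
- exact: pf2_comp.
- exact: phi_nat.
- exact: phi_assoc.
- exact: phi_lunit.
- exact: phi_runit.
Defined.
End LambdaFunctor.

Record shadow (B : bicategory) (T : category) := Shadow {
  sh : forall a : B, hom1 a a -> T;
  sh2 : forall (a : B) (f g : hom1 a a), hom f g -> hom (sh f) (sh g);
  theta : forall (a b : B) (M : hom1 a b) (N : hom1 b a),
    iso (sh (M ⊙ N)) (sh (N ⊙ M));
  sh2_id : forall (a : B) (f : hom1 a a), sh2 (idm f) = idm (sh f);
  sh2_comp : forall (a : B) (f g h : hom1 a a) (s : hom f g) (t : hom g h),
    sh2 (s ;; t) = sh2 s ;; sh2 t;
  theta_nat : forall (a b : B) (M M' : hom1 a b) (N N' : hom1 b a)
    (s : hom M M') (t : hom N N'),
    sh2 (s ** t) ;; theta M' N' = theta M N ;; sh2 (t ** s);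
  theta_hex : forall (a b c : B) (M : hom1 a b) (N : hom1 b c) (P : hom1 c a),
    theta (M ⊙ N) P ;; sh2 (bwd (assoc P M N)) =
    sh2 (assoc M N P) ;; theta M (N ⊙ P) ;; sh2 (assoc N P M) ;; theta N (P ⊙ M);
  theta_lunit : forall (a : B) (M : hom1 a a),
    theta M (unit1 a) ;; sh2 (lunit M) = sh2 (runit M);
  theta_runit : forall (a : B) (M : hom1 a a),
    theta (unit1 a) M ;; sh2 (runit M) = sh2 (lunit M)
}.

Arguments sh {B T} S {a} f : rename.
Arguments sh2 {B T} S {a f g} s : rename.
Arguments theta {B T} S {a b} M N : rename.

Section Trace.
Variables (B : bicategory) (T : category) (S : shadow B T).

Definition trace_with (a b : B) (Q : hom1 a a) (M : hom1 a b) (P : hom1 b b)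
    (d : right_dual M) (f : hom (Q ⊙ M) (M ⊙ P)) : hom (sh S Q) (sh S P) :=
  sh2 S (bwd (runit Q))
    ;; sh2 S (idm Q ** eta d)
    ;; sh2 S (bwd (assoc Q M (dob d)))
    ;; sh2 S (f ** idm (dob d))
    ;; theta S (M ⊙ P) (dob d)
    ;; sh2 S (bwd (assoc (dob d) M P))
    ;; sh2 S (eps d ** idm P)
    ;; sh2 S (lunit P).

Definition trace (a b : B) (Q : hom1 a a) (M : hom1 a b) (P : hom1 b b)
    (h : dualizable M) (f : hom (Q ⊙ M) (M ⊙ P)) : hom (sh S Q) (sh S P) :=
  trace_with (chosen_dual h) f.

Definition tr_in (a b : B) (Q : hom1 a a) (M : hom1 a b) (P : hom1 b b)
    (d : right_dual M) (f : hom (Q ⊙ M) (M ⊙ P)) : hom Q ((M ⊙ P) ⊙ dob d) :=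
  bwd (runit Q) ;; (idm Q ** eta d) ;; bwd (assoc Q M (dob d)) ;; (f ** idm (dob d)).

Definition tr_out (a b : B) (M : hom1 a b) (d : right_dual M) c (P : hom1 b c) :
    hom (dob d ⊙ (M ⊙ P)) P :=
  bwd (assoc (dob d) M P) ;; (eps d ** idm P) ;; lunit P.

Lemma trace_withE (a b : B) (Q : hom1 a a) (M : hom1 a b) (P : hom1 b b)
    (d : right_dual M) (f : hom (Q ⊙ M) (M ⊙ P)) :
  trace_with d f = sh2 S (tr_in d f) ;; theta S (M ⊙ P) (dob d) ;; sh2 S (tr_out d P).
Proof. by rewrite /trace_with /tr_in /tr_out !sh2_comp !compA. Qed.

Lemma trace_with_iso (a b : B) (Q : hom1 a a) (M M' : hom1 a b) (P : hom1 b b)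
    (d : right_dual M) (d' : right_dual M') (f : hom (Q ⊙ M) (M ⊙ P))
    (f' : hom (Q ⊙ M') (M' ⊙ P)) (i : iso M M') :
  (idm Q ** i) ;; f' = f ;; (i ** idm P) -> trace_with d f = trace_with d' f'.
Proof.
move=> E.
pose m := bwd (runit (dob d')) ;; (idm _ ** eta d) ;; (idm _ ** (i ** idm (dob d)))
   ;; bwd (assoc _ _ _) ;; (eps d' ** idm (dob d)) ;; lunit (dob d).
have C1 : tr_in d f ;; ((i ** idm P) ** idm (dob d)) = tr_in d' f' ;; (idm _ ** m).
  rewrite /tr_in /m.
  have t1 := tri1 d'; strictify t1.
  inter (eta d); inter (eta d'); inter (eps d'); inter f'; inter f.
  strictify E; inter (fwd i).
  strict.
  seta f' X F; seta (eta d') (X ⊙ Q) H.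
  have K1 := N _ _ _ (F ** idm (dob d')).
  have K2 := f_equal (fun u => u ** idm (dob d)) (N4 _ _ _ (F ** idm (dob d'))).
  have K3 := f_equal (fun u => u ** idm (dob d)) (N1 _ _ _ F).
  have K4 := f_equal (fun u => u ** idm (dob d)) (N4 _ _ _ H).
  rewrite /= !whisker_comp in K2 K3 K4.
  rewrite -(compA _ (F ** _)) K1 !compA -(compA _ (F ** _ ** _ ** _)) K2.
  rewrite !compA -(compA _ (F ** _ ** _ ** _)) K3 !compA N.
  rewrite -(compA _ (H ** _ ** _)) K4 !compA.
  rewrite -(compA _ (H ** _ ** _)) -(whisker_comp _ (H ** _)) t1; snf.
  by rewrite -!compA -!whisker_comp E.
have C2 : (m ** (bwd i ** idm P)) ;; tr_out d P = tr_out d' P.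
  rewrite /tr_out /m.
  have t1 := tri1 d; strictify t1.
  inter (eta d); inter (eps d); inter (eps d'); inter (fwd i); inter (bwd i).
  have iK := bwdK i; strictify iK.
  strict; rewrite -!whisker_comp; congr (_ ** _); snf.
  seta (eps d') X H; seta (eta d) (X ⊙ dob d') K; seta (fwd i) (X ⊙ dob d') J.
  rewrite -(compA _ (H ** _ ** _)) N3 !compA -(compA _ (H ** _ ** _)) N0 !compA.
  rewrite -(compA _ (J ** _ ** _)) N3 !compA -(compA _ (J ** _ ** _)) N0 !compA.
  by rewrite N3 -(compA _ (K ** _)) t1; snf; rewrite iK; snf.
rewrite !trace_withE.
have -> : tr_in d f = tr_in d' f' ;; ((bwd i ** idm P) ** m).
  rewrite hcomp_split' compA -C1 -compA -!whisker_comp fwdK.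
  by snf.
rewrite -C2 !sh2_comp !compA.
by rewrite -(compA _ (sh2 _ _) (fwd (theta _ _ _))) theta_nat !compA.
Qed.

Lemma sh2_iso_subproof (a : B) (f g : hom1 a a) (i : iso f g) :
  sh2 S i ;; sh2 S (bwd i) = idm _.
Proof. by rewrite -sh2_comp fwdK sh2_id. Qed.

Definition sh2_iso (a : B) (f g : hom1 a a) (i : iso f g) : iso (sh S f) (sh S g) :=
  Iso (sh2_iso_subproof i) (sh2_iso_subproof (iso_inv i)).

Lemma tr_out_nat (a b c : B) (M : hom1 a b) (d : right_dual M) (P P' : hom1 b c)
    (s : hom P P') :
  tr_out d P ;; s = (idm (dob d) ** (idm M ** s)) ;; tr_out d P'.
Proof.
rewrite /tr_out; inter s.
by strict; rewrite N.
Qed.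

Lemma tr_out_odot (a b c e : B) (M : hom1 a b) (d : right_dual M) (P : hom1 b c)
    (K : hom1 c e) :
  tr_out d (P ⊙ K) =
  (idm _ ** bwd (assoc M P K)) ;; bwd (assoc (dob d) (M ⊙ P) K) ;; (tr_out d P ** idm K).
Proof. by rewrite /tr_out; strict. Qed.

Lemma thetaK (a b : B) (M : hom1 a b) (N : hom1 b a) :
  theta S M N ;; theta S N M = idm _.
Proof.
have U (c : B) (X : hom1 c c) : fwd (theta S X (unit1 c)) = sh2 S (runit X ;; bwd (lunit X)).
  by rewrite sh2_comp -theta_lunit -compA -sh2_comp fwdK sh2_id comp_idr.
have H := theta_hex S M N (unit1 a).
rewrite U -sh2_comp in H.
have E1 : fwd (theta S M (N ⊙ unit1 a)) =
   sh2 S (idm M ** runit N) ;; theta S M N ;; sh2 S (bwd (runit N) ** idm M).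
  by rewrite theta_nat -compA -sh2_comp -whisker_comp fwdK hcomp_id sh2_id comp_idr.
have E2 : fwd (theta S N (unit1 a ⊙ M)) =
   sh2 S (idm N ** lunit M) ;; theta S N M ;; sh2 S (bwd (lunit M) ** idm N).
  by rewrite theta_nat -compA -sh2_comp -whisker_comp fwdK hcomp_id sh2_id comp_idr.
rewrite E1 E2 !compA in H.
have E3 : sh2 S (bwd (runit N) ** idm M) ;; sh2 S (assoc N (unit1 a) M)
   ;; sh2 S (idm N ** lunit M) = idm _.
  rewrite -!sh2_comp -[RHS]sh2_id; congr (sh2 S _).
  by strict.
rewrite -(compA _ (sh2 _ _) (sh2 _ (assoc _ _ _))) in H.
rewrite -(compA _ (_ ;; _) (sh2 _ (_ ** lunit _))) E3 comp_idr in H.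
have E4 : sh2 S (runit (M ⊙ N) ;; bwd (lunit (M ⊙ N)) ;; bwd (assoc (unit1 a) M N)) =
  sh2 S (assoc M N (unit1 a)) ;; sh2 S (idm M ** runit N)
    ;; sh2 S (bwd (lunit M) ** idm N).
  by rewrite -!sh2_comp; congr (sh2 S _); strict.
rewrite E4 -!compA in H.
have := iso_monoL (i := sh2_iso (assoc M N (unit1 a))) H.
move/(iso_monoL (i := sh2_iso (hcomp_iso (iso_id M) (runit N)))) => {}H.
apply: (iso_monoR (i := sh2_iso (hcomp_iso (iso_inv (lunit M)) (iso_id N)))) => /=.
by rewrite -compA -H comp_idl.
Qed.

Lemma theta_hex' (a b c : B) (X : hom1 a b) (Y : hom1 b c) (Z : hom1 c a) :
  theta S (X ⊙ Y) Z ;; sh2 S (bwd (assoc Z X Y)) ;; theta S (Z ⊙ X) Y =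
  sh2 S (assoc X Y Z) ;; theta S X (Y ⊙ Z) ;; sh2 S (assoc Y Z X).
Proof. by rewrite theta_hex -!compA thetaK comp_idr. Qed.

Lemma trace_with_odot (a b c : B) (P : hom1 a a) (Q : hom1 b b) (T' : hom1 c c)
    (M : hom1 a b) (N : hom1 b c) (dM : right_dual M) (dN : right_dual N)
    (f : hom (P ⊙ M) (M ⊙ Q)) (g : hom (Q ⊙ N) (N ⊙ T')) :
  trace_with (dual_comp dM dN)
    (bwd (assoc P M N) ;; (f ** idm N) ;; assoc M Q N ;; (idm M ** g)
       ;; bwd (assoc M N T')) =
  trace_with dM f ;; trace_with dN g.
Proof.
rewrite !trace_withE !compA.
have IN : tr_in (dual_comp dM dN)
    (bwd (assoc P M N) ;; (f ** idm N) ;; assoc M Q N ;; (idm M ** g)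
       ;; bwd (assoc M N T')) ;; (assoc M N T' ** idm (dob dN ⊙ dob dM)) =
  tr_in dM f ;; (((idm M ** tr_in dN g) ;; bwd (assoc _ _ _)) ** idm (dob dM))
    ;; assoc (M ⊙ (N ⊙ T')) (dob dN) (dob dM).
  rewrite /tr_in /=; inter (eta dN).
  strict.
  seta f X F.
  by rewrite -(compA _ (F ** idm (dob dM))) -(whisker_comp _ F) N0; snf.
have OUT : (idm (dob dN ⊙ dob dM) ** bwd (assoc M N T')) ;; tr_out (dual_comp dM dN) T' =
  assoc (dob dN) (dob dM) (M ⊙ (N ⊙ T')) ;; (idm (dob dN) ** tr_out dM (N ⊙ T'))
    ;; tr_out dN T'.
  by rewrite /tr_out /=; strict.
rewrite -(compA _ (sh2 S (tr_out dM Q))) -sh2_comp tr_out_nat tr_out_odot.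
have -> : fwd (theta S ((M ⊙ N) ⊙ T') (dob (dual_comp dM dN))) =
    sh2 S (assoc M N T' ** idm _) ;; theta S (M ⊙ (N ⊙ T')) (dob dN ⊙ dob dM)
      ;; sh2 S (idm _ ** bwd (assoc M N T')).
  by rewrite theta_nat -compA -sh2_comp -whiskel_comp fwdK hcomp_id sh2_id comp_idr.
rewrite !compA -sh2_comp IN -(compA _ (sh2 S _) (sh2 S (tr_out (dual_comp _ _) _))).
rewrite -sh2_comp OUT !sh2_comp !compA -(compA _ _ (theta S _ (dob dN ⊙ dob dM))).
rewrite -(compA _ _ (sh2 S (assoc _ _ _))) -theta_hex'.
rewrite !compA -(compA _ _ (sh2 S (_ ** tr_out dM _))) -theta_nat.
rewrite -(compA _ (sh2 S (_ ** (idm M ** _))) (sh2 S (_ ** bwd _))).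
rewrite -(sh2_comp S (_ ** (idm M ** _)) (_ ** bwd _)) -whiskel_comp.
by rewrite -(compA _ (fwd (theta S (M ⊙ Q) _))) -theta_nat !compA.
Qed.

Lemma trace_with_unit (a : B) (P : hom1 a a) :
  trace_with (dual_unit a) (runit P ;; bwd (lunit P)) = idm (sh S P).
Proof.
rewrite trace_withE.
have -> : fwd (theta S (unit1 a ⊙ P) (dob (dual_unit a))) =
    sh2 S (runit _ ;; bwd (lunit _)).
  by rewrite sh2_comp -theta_lunit -compA -sh2_comp fwdK sh2_id comp_idr.
rewrite -!sh2_comp -sh2_id; congr (sh2 S _).
rewrite /tr_in /tr_out /=.
by strict.
Qed.
End Trace.

Lemma eq_irr (A : Type) (x y : A) (p q : x = y) : p = q.
Proof. exact: proof_irrelevance. Qed.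

Definition eq_category (A : Type) : category :=
  @Category A (fun x y => x = y) (fun x => eq_refl) (fun x y z => @eq_trans A x y z)
    (fun _ _ _ => eq_irr _ _) (fun _ _ _ => eq_irr _ _)
    (fun _ _ _ _ _ _ _ => eq_irr _ _).

Definition eq_iso (A : Type) (x y : eq_category A) (e : x = y) : iso x y :=
  @Iso (eq_category A) x y e (eq_sym e) (eq_irr _ _) (eq_irr _ _).

(* The category T as a 2-category with only identity 2-cells: a 2-cell f => g is
   a proof of f = g. *)
Definition discrete (T : category) : bicategory :=
  @Bicategory T (fun x y => eq_category (hom x y)) (fun x => idm x)
    (fun x y z f g => f ;; g)
    (fun x y z f f' g g' s t => f_equal2 (fun u v => u ;; v) s t)
    (fun x y z w f g h => eq_iso (eq_sym (compA f g h)))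
    (fun x y f => eq_iso (comp_idl f))
    (fun x y f => eq_iso (comp_idr f))
    (fun _ _ _ _ _ => eq_irr _ _)
    (fun _ _ _ _ _ _ _ _ _ _ _ _ _ => eq_irr _ _)
    (fun _ _ _ _ _ _ _ _ _ _ _ _ _ => eq_irr _ _)
    (fun _ _ _ _ _ => eq_irr _ _)
    (fun _ _ _ _ _ => eq_irr _ _)
    (fun _ _ _ _ _ _ _ _ _ => eq_irr _ _)
    (fun _ _ _ _ _ => eq_irr _ _).

Section Chi.
Variables (B : bicategory) (T : category) (S : shadow B T).

Definition chi1 (P Q : Lambda B) (f : hom1 P Q) : hom (sh S (e1 P)) (sh S (e1 Q)) :=
  trace S (ldual f) (lpsi f).

Lemma chi2 (P Q : Lambda B) (f g : hom1 P Q) (s : hom f g) : chi1 f = chi1 g.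
Proof. exact: trace_with_iso (l2_eq s). Qed.

Lemma trace_with_indep (a b : B) (Q : hom1 a a) (M : hom1 a b) (P : hom1 b b)
    (d d' : right_dual M) (f : hom (Q ⊙ M) (M ⊙ P)) :
  trace_with S d f = trace_with S d' f.
Proof.
apply: (@trace_with_iso B T S a b Q M M P d d' f f (iso_id M)).
by rewrite /=; snf.
Qed.

Lemma chi_odot (P Q R : Lambda B) (f : hom1 P Q) (g : hom1 Q R) :
  chi1 f ;; chi1 g = chi1 (f ⊙ g).
Proof.
rewrite /chi1 /trace -trace_with_odot; exact: trace_with_indep.
Qed.

Lemma chi_unit (P : Lambda B) : idm (sh S (e1 P)) = chi1 (unit1 P).
Proof.
rewrite /chi1 /trace -trace_with_unit; exact: trace_with_indep.
Qed.

(* The comparison 2-cells are identities, as are all 2-cells of [discrete T]. *)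
Definition chi : pseudofunctor (Lambda B) (discrete T).
Proof.
refine (@Pseudofunctor (Lambda B) (discrete T) (fun P => sh S (e1 P)) chi1 chi2
  (fun P Q R f g => eq_iso (chi_odot f g))
  (fun P => eq_iso (chi_unit P)) _ _ _ _ _ _);
  move=> *; exact: eq_irr.
Defined.
End Chi.

Definition character (A B : bicategory) (T : category) (S : shadow B T)
    (s : pseudofunctor A B) : pseudofunctor (Lambda A) (discrete T) :=
  pf_comp (lambda_pf s) (chi S).

(* The bicategory rho ↓ iota^*, of which only the cells are needed.  With
   B := discrete T, rho := X_rho and iota := Λiota it is X_rho ↓ (Λiota)^*: there
   modifications are equalities between components. *)
Section Under.
Variables (C D B : bicategory) (rho : pseudofunctor C B) (iota : pseudofunctor C D).

Record under_ob := UnderOb {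
  uo_fun : pseudofunctor D B;
  uo_tr : strong_trans rho (pf_comp iota uo_fun)
}.

Record under_hom (X Y : under_ob) := UnderHom {
  uh_tr : strong_trans (uo_fun X) (uo_fun Y);
  uh_mod : modification (trans_comp (uo_tr X) (trans_whisker iota uh_tr)) (uo_tr Y)
}.

Record under_hom2 (X Y : under_ob) (u v : under_hom X Y) := UnderHom2 {
  uh2_mod :> modification (uh_tr u) (uh_tr v);
  uh2_eq : forall c,
    (idm (uo_tr X c) ** uh2_mod (iota c)) ;; uh_mod v c = uh_mod u c
}.

(* Bicategorical initiality: every hom-category out of X is equivalent to the
   terminal category.  Only 0-, 1- and 2-cells are involved. *)
Definition initial (X : under_ob) : Prop :=
  forall Y : under_ob,
    inhabited (under_hom X Y) /\
    forall u v : under_hom X Y, exists! g : under_hom2 u v, True.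

End Under.

Definition all_dualizable (B : bicategory) : Prop :=
  forall (a b : B) (M : hom1 a b), dualizable M.

(* X is a 0-cell of the subbicategory (rho ↓ iota^* )^d. *)
Definition dualizable_under (C D B : bicategory) (rho : pseudofunctor C B)
    (iota : pseudofunctor C D) (X : under_ob rho iota) : Prop :=
  forall c : C, dualizable (uo_tr X c).

(* Main.v *)
From Stdlib Require Import ssreflect ProofIrrelevance FunctionalExtensionality.
Require Import Defs.

Set Implicit Arguments.
Unset Strict Implicit.
Unset Printing Implicit Defensive.

(* The 2-cell [zeta_f^-1] makes each component of a strong transformation [zeta]
   with dualizable components a 1-cell [(zeta_a, zeta_f^-1)] of [Lambda B], and
   [zeta_m] is an invertible 2-cell filling the naturality square of this family
   at a 1-cell [(m, psi)] of [Lambda C].  Applying [chi], which kills 2-cells,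
   turns these squares into the naturality of [f |-> tr(zeta_f^-1)].  The rest is
   initiality of [J]: a modification into a discrete bicategory is a family of
   equalities, so the 1-cells out of [J] are not only isomorphic but equal. *)

Section TraceTransformation.
Variables (C B : bicategory) (F G : pseudofunctor C B) (z : strong_trans F G).

(** [st_odot] at both factorizations, joined by [st_nat] at [s]; the inverse [phi] on the [F] side
    is cancelled first. *)
Lemma st_odot_square (a b d e : C) (f : hom1 a b) (g : hom1 b e)
    (f' : hom1 a d) (g' : hom1 d e) (s : hom (f ⊙ g) (f' ⊙ g')) :
  bwd (assoc (z a) (pf1 G f) (pf1 G g)) ;; (tr2 z f ** idm (pf1 G g)) ;; assoc _ _ _
    ;; (idm (pf1 F f) ** tr2 z g) ;; bwd (assoc _ _ _)
    ;; ((phi F f g ;; pf2 F s ;; bwd (phi F f' g')) ** idm (z e)) =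
  (idm (z a) ** (phi G f g ;; pf2 G s ;; bwd (phi G f' g')))
    ;; (bwd (assoc _ _ _) ;; (tr2 z f' ** idm (pf1 G g')) ;; assoc _ _ _
         ;; (idm (pf1 F f') ** tr2 z g') ;; bwd (assoc _ _ _)).
Proof.
apply: (iso_monoR (i := hcomp_iso (phi F f' g') (iso_id (z e)))) => /=.
rewrite -[RHS]compA -(st_odot z f' g') !whisker_comp !whiskel_comp !compA -st_odot.
rewrite -[LHS]compA -whisker_comp bwdK hcomp_id comp_idr.
rewrite -(compA _ (_ ** bwd _)) -(whiskel_comp _ (bwd _)) bwdK hcomp_id comp_idr.
by rewrite -!compA st_nat.
Qed.

Variable dz : forall c : C, dualizable (z c).

Definition trans_lhom (P : Lambda C) : hom1 (lpf0 F P) (lpf0 G P) :=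
  @LHom1 B (lpf0 F P) (lpf0 G P) (z (e0 P)) (dz (e0 P)) (bwd (tr2 z (e1 P))).

Lemma trans_lhom_square (P Q : Lambda C) (f : hom1 P Q) :
  (idm (pf1 F (e1 P)) ** tr2 z (lm f)) ;; lpsi (lpf1 F f ⊙ trans_lhom Q) =
  lpsi (trans_lhom P ⊙ lpf1 G f) ;; (tr2 z (lm f) ** idm (pf1 G (e1 Q))).
Proof.
have E := st_odot_square (lpsi f).
have Kx := bwdK (tr2 z (e1 P)); have Ky := fwdK (tr2 z (e1 Q)).
rewrite /= in E Kx Ky *.
(* Named so that strictification treats each conjugate of [lpsi f] as one atom. *)
move: E; set SF := (phi F _ _ ;; _ ;; _); set SG := (phi G _ _ ;; _ ;; _) => E.
strictify E; strictify Kx; strictify Ky.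
strict.
(* Inserting [tr2 z (e1 P)] after its inverse exposes the left side of [E]; the [tr2 z (e1 Q)] that
   [E] produces then cancels. *)
rewrite -[LHS]comp_idl -hcomp_id -Kx whisker_comp !compA.
by rewrite -3!(compA (_ ** _)) E -!compA Ky comp_idr.
Qed.

Lemma trace_trans_nat (T : category) (S : shadow B T) (P Q : Lambda C) (f : hom1 P Q) :
  trace S (dz (e0 P)) (bwd (tr2 z (e1 P))) ;; chi1 S (lpf1 G f) =
  chi1 S (lpf1 F f) ;; trace S (dz (e0 Q)) (bwd (tr2 z (e1 Q))).
Proof.
rewrite (chi_odot S (trans_lhom P) (lpf1 G f)) (chi_odot S (lpf1 F f) (trans_lhom Q)).
exact: trace_with_iso (trans_lhom_square f).
Qed.

End TraceTransformation.

(** The two traces differ only in the chosen dual and in how [phi] and [pf2] are bracketed, so the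
    identity 2-cell compares them. *)
Lemma character_pf_comp1 (A B C : bicategory) (T : category) (S : shadow C T)
    (F : pseudofunctor A B) (G : pseudofunctor B C) (P Q : Lambda A) (f : hom1 P Q) :
  pf1 (character S (pf_comp F G)) f = pf1 (pf_comp (lambda_pf F) (character S G)) f.
Proof.
apply: trace_with_iso (iso_id _) _.
by rewrite /= hcomp_id comp_idl hcomp_id comp_idr !pf2_comp !compA.
Qed.

Section DiscreteUnder.
Variables (C D : bicategory) (T : category) (rho : pseudofunctor C (discrete T))
  (iota : pseudofunctor C D).

(** Naturality 2-cells here are equality proofs, so they carry no data. *)
Lemma strong_trans_discrete_eq (A : bicategory) (F G : pseudofunctor A (discrete T))
    (z w : strong_trans F G) : (forall a, z a = w a) -> z = w.
Proof.
case: z => -[z1 z2] zn zo zu; case: w => -[w1 w2] wn wo wu /= E.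
have {}E : z1 = w1 by apply: functional_extensionality_dep.
subst w1.
have E : z2 = w2.
  do 3 (apply: functional_extensionality_dep => ?).
  by apply: iso_eq; exact: eq_irr.
subst w2; congr StrongTrans; exact: proof_irrelevance.
Qed.

Lemma under_hom_discrete_eq (X Y : under_ob rho iota) (u v : under_hom X Y) :
  (forall d, uh_tr u d = uh_tr v d) -> u = v.
Proof.
case: u => z m; case: v => w n /= /strong_trans_discrete_eq E; subst w.
congr UnderHom; case: m => m mn; case: n => n nn.
have E : m = n by apply: functional_extensionality_dep => c; exact: eq_irr.
subst n; congr Modification; exact: proof_irrelevance.
Qed.

Lemma initial_discrete_unique (X Y : under_ob rho iota) :
  initial X -> exists! u : under_hom X Y, True.
Proof.
move=> /(_ Y) [[u] uniq]; exists u; split=> // v _.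
have [g _] := uniq u v.
by apply: under_hom_discrete_eq => d; exact: (g d).
Qed.
End DiscreteUnder.

Theorem theorem4p16 (C D B : bicategory) (T : category) (S : shadow B T)
  (dC : all_dualizable C) (dD : all_dualizable D)
  (iota : pseudofunctor C D) (rho : pseudofunctor C B)
  (I : under_ob rho iota) (initI : initial I) (dI : dualizable_under I)
  (J : under_ob (character S rho) (lambda_pf iota)) (initJ : initial J) :
  exists mu : strong_trans (character S rho)
                (pf_comp (lambda_pf iota) (character S (uo_fun I))),
    (forall f : Lambda C,
       mu f = trace S (dI (e0 f)) (bwd (tr2 (uo_tr I) (e1 f)))) /\
    exists! k : under_hom J (UnderOb mu), True.
Proof.
pose mu0 (P : Lambda C) := trace S (dI (e0 P)) (bwd (tr2 (uo_tr I) (e1 P))).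
have nat (P Q : Lambda C) (f : hom1 P Q) :
    mu0 P ;; pf1 (pf_comp (lambda_pf iota) (character S (uo_fun I))) f =
    pf1 (character S rho) f ;; mu0 Q.
  (* [uo_tr I] ends at [pf_comp iota (uo_fun I)], so its trace lands in the character of that
     composite. *)
  rewrite -character_pf_comp1; exact: (trace_trans_nat (z := uo_tr I) dI S f).
unshelve eexists (@StrongTrans _ _ _ _ (@TransData _ _ (character S rho)
  (pf_comp (lambda_pf iota) (character S (uo_fun I))) mu0
  (fun P Q f => eq_iso (nat P Q f))) _ _ _); try by move=> *; exact: eq_irr.
by split=> //; exact: initial_discrete_unique.
Qed.
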